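(* Let $(X,P)$ be an irreducible random walk on $X=\mathbb{Z}$ with i.i.d. increments, bounded jumps and drift to the right. Let $\mu$ be an offspring distribution with mean $m$. If $m>1/\rho(P)$, then the branching random walk $(X,P,\mu)$ with constant offspring distribution $\mu$ is positive recurrent.
   Context: The random walk is $S_n=\sum_{i=1}^n X_i$ with i.i.d. integer-valued increments $X_i$; bounded jumps means $|X_i|\le d$ for some $d\in\mathbb{N}$; drift to the right means $E[X_i]>0$; the walk is irreducible on $\mathbb{Z}$. $P=(p(x,y))$ is its transition matrix, $p^{(n)}$ the $n$-step transition probabilities and $\rho(P):=\limsup_{n\to\infty}(p^{(n)}(x,y))^{1/n}$ its spectral radius (independent of $x,y$). An offspring distribution $\mu=(\mu_k)_{k\ge1}$ is a probability distribution on $\{1,2,\dots\}$ with finite mean $m=\sum_k k\mu_k$. The branching random walk $(X,P,\mu)$ with constant offspring distribution starts with one particle; at each time step each particle, located at $y$ say, is replaced by $k$ offspring with probability $\mu_k$, and each offspring then independently moves to $z$ with probability $p(y,z)$, everything being independent of the other particles and of the past. Let $\eta(n)$ be the number of particles at time $n$, $x_i(n)$ the position of the $i$-th particle at time $n$, and $\mathbb{P}_x$, $\mathbb{E}_x$ the law and expectation for the process started with one particle at $x$. Let $\alpha(x):=\mathbb{P}_x\big(\sum_{n\ge1}\sum_{i=1}^{\eta(n)}\mathbf 1\{x_i(n)=x\}=\infty\big)$; the process is recurrent if $\alpha(x)>0$ for all $x$. A recurrent process is positive recurrent if $\mathbb{E}_xT_x<\infty$ for all $x\in X$, where $T_x:=\inf\{n>0:\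 \exists\, i\in\{1,\dots,\eta(n)\}:\ x_i(n)=x\}$. *)

(* Defs.v *)
From HB Require Import structures.
From mathcomp Require Import all_boot all_order all_algebra.
From mathcomp Require Import all_classical all_reals all_analysis.

Set Implicit Arguments.
Unset Strict Implicit.
Unset Printing Implicit Defensive.

Import Order.TTheory GRing.Theory Num.Theory.

Local Open Scope classical_set_scope.
Local Open Scope ring_scope.

(* [set int] and [set (seq int)] are taken with the discrete sigma-algebra, so
   measurability of an int- or (seq int)-valued map is about all preimages. *)

Definition iid (R : realType) (d : measure_display) (T : measurableType d)
    (P0 : probability T R) (X : nat -> T -> int) : Prop :=
  [/\ forall i (B : set int), measurable (X i @^-1` B),
      forall i (B : set int), P0 (X i @^-1` B) = P0 (X 0%N @^-1` B) &
      forall (J : seq nat) (B : nat -> set int), uniq J ->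
        P0 (\bigcap_(i in [set` J]) (X i @^-1` B i)) =
        (\prod_(i <- J) P0 (X i @^-1` B i))%E].

Definition bounded_jumps (R : realType) (d : measure_display)
    (T : measurableType d) (P0 : probability T R) (X : nat -> T -> int) : Prop :=
  exists b : nat, forall i, {ae P0, forall w, `|X i w| <= b%:Z}.

(* The increments are indexed from 0: S_n = X_0 + ... + X_(n-1). *)
Definition drift_right (R : realType) (d : measure_display)
    (T : measurableType d) (P0 : probability T R) (X : nat -> T -> int) : Prop :=
  (0 < 'E_P0[fun w => (X 0%N w)%:~R : R])%E.

Definition transition (R : realType) (d : measure_display)
    (T : measurableType d) (P0 : probability T R) (X : nat -> T -> int)
    (x y : int) : R :=
  fine (P0 [set w | x + X 0%N w = y]).

Section TransitionMatrix.
Variables (R : realType) (p : int -> int -> R).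

Fixpoint nstep (n : nat) (x y : int) : R :=
  if n is n'.+1 then fine (\esum_(z in [set: int]) (p x z * nstep n' z y)%:E)
  else (x == y)%:R.

Definition irreducible : Prop := forall x y, exists n, 0 < nstep n x y.

Definition spectral_radius (x y : int) : R :=
  limn_sup (fun n => nstep n x y `^ (n%:R^-1)).

End TransitionMatrix.

Definition offspring_distribution (R : realType) (mu : nat -> R) : Prop :=
  [/\ mu 0%N = 0, forall k, 0 <= mu k & (\sum_(0 <= k <oo) (mu k)%:E = 1)%E].

Definition offspring_mean (R : realType) (mu : nat -> R) (m : R) : Prop :=
  (\sum_(0 <= k <oo) (k%:R * mu k)%:E = m%:E)%E.

Section BranchingRandomWalk.
Variables (R : realType) (p : int -> int -> R) (mu : nat -> R).

(* A generation is the list of the positions of its particles, the children of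
   the first particle coming first, then those of the second, and so on. *)

(* Probability that a particle at y has exactly size t children, the i-th of
   which ends up at the i-th entry of t. *)
Definition children (y : int) (t : seq int) : R :=
  mu (size t) * \prod_(z <- t) p y z.

(* One-step probability from generation s to generation t, summing over the
   number k of children of the first particle. *)
Fixpoint generation_step (s t : seq int) : R :=
  if s is y :: s' then
    \sum_(k < (size t).+1) children y (take k t) * generation_step s' (drop k t)
  else (t == [::])%:R.

Variables (d : measure_display) (T : measurableType d).
Variables (PP : int -> probability T R) (Y : nat -> T -> seq int).

Definition branching_random_walk : Prop :=
  (forall n (B : set (seq int)), measurable (Y n @^-1` B)) /\
  (forall (x : int) (n : nat) (s : nat -> seq int),
     PP x [set w | forall i, (i <= n)%N -> Y i w = s i] =
     ((s 0%N == [:: x])%:R * \prod_(i < n) generation_step (s i) (s i.+1))%:E).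

Definition eta (n : nat) (w : T) : nat := size (Y n w).

Definition position (n : nat) (w : T) (i : nat) : int := nth 0 (Y n w) i.

Definition visits (x : int) (w : T) : \bar R :=
  (\sum_(1 <= n <oo) \sum_(i < eta n w) (position n w i == x)%:R%:E)%E.

Definition alpha (x : int) : \bar R := PP x [set w | visits x w = +oo%E].

Definition recurrent : Prop := forall x, (0 < alpha x)%E.

Definition return_time (x : int) (w : T) : \bar R :=
  ereal_inf [set n%:R%:E | n in
    [set n | (0 < n)%N /\ exists2 i, (i < eta n w)%N & position n w i = x]].

Definition positive_recurrent : Prop :=
  recurrent /\ forall x, (\int[PP x]_w return_time x w < +oo)%E.

End BranchingRandomWalk.

(* Main.v *)
Require Import Defs.
From HB Require Import structures.
From mathcomp Require Import all_boot all_order all_algebra.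
From mathcomp Require Import all_classical all_reals all_analysis.
From mathcomp Require Import measurable_realfun ring lra zify.

Set Implicit Arguments.
Unset Strict Implicit.
Unset Printing Implicit Defensive.

Import Order.TTheory GRing.Theory Num.Theory.
Import numFieldNormedType.Exports.

Local Open Scope classical_set_scope.
Local Open Scope ring_scope.

(** The branching property turns the process into the iteration of a map on
    functions on the integers. Let [step] be the one-step operator of the walk
    and [pgf] the generating function of the offspring law. The probability
    [avoid a n y] that the process started at [y] has no particle at [a] in the
    generations 0, ..., [n - 1] satisfies
      [avoid a n.+1 y = (y != a)%:R * pgf (step (avoid a n) y)],
    and everything follows from the fact that it decays like [n ^- 2], with a
    constant depending on the distance from [y] to [a] ([avoid_quadratic]).

    Supercriticality in space. If [m] exceeds the inverse of the spectral
    radius, then for some [m' < m] there are [N1] and [N2] such that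
    [m' ^+ N1 * p^(N1)(0, 1)] and [m' ^+ N2 * p^(N2)(0, -1)] exceed 1
    ([supercritical_path]): the particles that move by one site every [N1]
    generations form a supercritical Galton-Watson process. Its analytic form is
    [pgf (1 - s) <= 1 - m' * s] for small [s], by which a small hitting
    probability [q] is handed on to the neighbouring sites without loss. So [a]
    is met from distance [L] with probability at least [q], within a number of
    generations linear in [L] ([avoid_hit]).

    Rare failure. Since every particle has a child and the mean number of
    children exceeds 1, there is [kappa < 1] with [pgf s <= kappa * s] for
    [s <= 1 - q]. So [k] preliminary generations turn the failure probability
    [1 - q] into at most [kappa ^+ k] ([avoid_boost]), while the particles move
    by a bounded distance only. If the attempt fails, the particles are still
    within a distance [A * L], where [A] does not depend on [k], and another
    attempt is made from there ([avoid_split]). The scale grows by the factor [A]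
    at each attempt and the failure probability shrinks by a factor as small as
    desired, which gives the polynomial decay.

    Back to the process. Summing over the possible next generations
    ([generation_step_prod]) and using the Markov property
    ([cylinder_confined]), the probability that no particle is at [x] during the
    generations [n], ..., [n + k - 1] is at most a constant times [k ^- 2]. Letting
    [k] grow, [x] is almost surely visited after any time, so [alpha x = 1]; and
    for [n = 1] the sum over [k] bounds the expected return time. *)

(** * Generating function of the offspring law *)

Lemma nneseries_le (R : realType) (u : nat -> R) (c : R) : (forall k, 0 <= u k) ->
  (forall n, \sum_(0 <= k < n) u k <= c) ->
  (\sum_(0 <= k <oo) (u k)%:E <= c%:E)%E.
Proof.
move=> u0 uc; apply: lime_le.
  by apply: is_cvg_nneseries => k _ _; rewrite lee_fin.
by apply: nearW => n; rewrite sumEFin lee_fin.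
Qed.

Lemma exprn_1B_le (R : realType) (s : R) k : 0 <= s <= 1 ->
  (1 - s) ^+ k <= 1 - k%:R * s + k%:R ^+ 2 * s ^+ 2.
Proof.
move=> /andP[s0 s1]; elim: k => [|k IH]; first by rewrite expr0; lra.
rewrite exprS; apply: le_trans (ler_wpM2l _ IH) _; first by lra.
rewrite -[k.+1]addn1 natrD; have : 0 <= k%:R :> R by [].
move: (k%:R) => x x0; have xs : 0 <= x * s ^+ 2 by rewrite mulr_ge0 ?exprn_ge0.
have : 0 <= x ^+ 2 * s ^+ 3 by rewrite mulr_ge0 ?exprn_ge0.
by nra.
Qed.

Section Pgf.
Variables (R : realType) (mu : nat -> R).

Definition pgf (s : R) : R := fine (\sum_(0 <= k <oo) (mu k * s ^+ k)%:E)%E.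

Hypothesis hmu : offspring_distribution mu.

Let mu0 : mu 0%N = 0. Proof. by case: hmu. Qed.
Let mu_ge0 k : 0 <= mu k. Proof. by case: hmu. Qed.

Lemma partial_sum_offspring_le1 n : \sum_(0 <= k < n) mu k <= 1.
Proof.
rewrite -lee_fin -sumEFin; case: hmu => _ _ <-.
by apply: nneseries_lim_ge => k _ _; rewrite lee_fin.
Qed.

Lemma pgf_term_ge0 s k : 0 <= s -> 0 <= mu k * s ^+ k.
Proof. by move=> s0; rewrite mulr_ge0 ?exprn_ge0. Qed.

Lemma pgfE s : 0 <= s <= 1 ->
  (\sum_(0 <= k <oo) (mu k * s ^+ k)%:E)%E = (pgf s)%:E.
Proof.
move=> /andP[s0 s1]; rewrite /pgf fineK// ge0_fin_numE; last first.
  by apply: nneseries_ge0 => k _ _; rewrite lee_fin pgf_term_ge0.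
apply: (@le_lt_trans _ _ 1%E); last exact: ltry.
apply: nneseries_le => [k|n]; first exact: pgf_term_ge0.
apply: le_trans (partial_sum_offspring_le1 n).
by apply: ler_sum => k _; rewrite ler_piMr// exprn_ile1.
Qed.

Lemma pgf_ge0 s : 0 <= s <= 1 -> 0 <= pgf s.
Proof.
move=> s01; rewrite -lee_fin -pgfE//; apply: nneseries_ge0 => k _ _.
by case/andP: s01 => s0 _; rewrite lee_fin pgf_term_ge0.
Qed.

Lemma ler_pgf s t : 0 <= s -> s <= t -> t <= 1 -> pgf s <= pgf t.
Proof.
move=> s0 st t1; rewrite -lee_fin -!pgfE ?s0 ?t1 ?(le_trans s0 st) ?(le_trans st t1)//.
apply: lee_nneseries => [k _ _|k _]; first by rewrite lee_fin pgf_term_ge0.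
by rewrite lee_fin ler_wpM2l// lerXn2r// nnegrE// (le_trans s0).
Qed.

(** The constant term of the series vanishes and [c ^+ k <= c] for [k >= 1]. As
    there is at least one child, a factor [c] on the failure probability of each
    child is also gained on the probability that all of them fail. *)
Lemma pgf_scale c s : 0 <= c <= 1 -> 0 <= s <= 1 -> pgf (c * s) <= c * pgf s.
Proof.
move=> c01 s01; move: (c01) (s01) => /andP[c0 c1] /andP[s0 s1].
have cs01 : 0 <= c * s <= 1 by rewrite mulr_ge0 ?mulr_ile1.
rewrite -lee_fin EFinM -!pgfE// -nneseriesZl//; last first.
  by move=> k _; rewrite lee_fin pgf_term_ge0.
apply: lee_nneseries => [k _ _|k _].
  by rewrite lee_fin pgf_term_ge0// mulr_ge0.
rewrite -EFinM lee_fin; case: k => [|k]; first by rewrite mu0 !mul0r mulr0.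
rewrite mulrCA ler_wpM2l// exprMn ler_wpM2r ?exprn_ge0//.
by rewrite exprS ler_piMr// exprn_ile1.
Qed.

Lemma pgf_le1 s : 0 <= s <= 1 -> pgf s <= 1.
Proof.
move=> /andP[s0 s1]; have -> : 1 = pgf 1.
  apply: EFin_inj; rewrite -pgfE ?lexx ?ler01//; case: hmu => _ _ <-.
  by apply: eq_eseriesr => k _; rewrite expr1n mulr1.
exact: ler_pgf.
Qed.

Lemma pgf_le s : 0 <= s <= 1 -> pgf s <= s.
Proof.
move=> s01; rewrite -[X in pgf X]mulr1 (le_trans (pgf_scale s01 _))//.
  by rewrite lexx ler01.
by case/andP: s01 => s0 _; rewrite ler_piMr// pgf_le1// lexx ler01.
Qed.

(** The slope of [pgf] at 1 is the mean [m]. The mean of the law truncated at a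
    large [K] already exceeds [m'], and its second moment [Q] is finite, which
    controls the quadratic error. *)
Lemma pgf_near1 m m' : offspring_mean mu m -> m' < m ->
  exists2 s0 : R, 0 < s0 <= 1 &
    forall s, 0 <= s <= s0 -> pgf (1 - s) <= 1 - m' * s.
Proof.
move=> hm m'm.
have kmu0 k : 0 <= k%:R * mu k by rewrite mulr_ge0.
have [K hK] : exists K, m' < \sum_(0 <= k < K) k%:R * mu k.
  apply/not_existsP => H; move: m'm; apply/negP; rewrite -leNgt -lee_fin -hm.
  apply: nneseries_le => // n; rewrite leNgt; apply/negP; exact: H.
set A := \sum_(0 <= k < K) _ in hK.
pose Q := \sum_(0 <= k < K) k%:R ^+ 2 * mu k.
have Q0 : 0 <= Q by apply: sumr_ge0 => k _; rewrite mulr_ge0 ?exprn_ge0.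
exists (Num.min 1 ((A - m') / (Q + 1))).
  by rewrite lt_min ltr01 divr_gt0 ?subr_gt0 ?ltr_wpDl ?ge_min ?lexx.
move=> s /andP[s0]; rewrite le_min => /andP[s1]; rewrite ler_pdivlMr ?ltr_wpDl// => sQ.
have s01 : 0 <= 1 - s <= 1 by lra.
rewrite -lee_fin -pgfE//; apply: nneseries_le => [k|n]; first by apply: pgf_term_ge0; lra.
pose f k := mu k * (1 - (1 - s) ^+ k).
have f0 k : 0 <= f k by rewrite mulr_ge0// subr_ge0 exprn_ile1//; lra.
have fK : s * A - s ^+ 2 * Q <= \sum_(0 <= k < K) f k.
  rewrite /A /Q !mulr_sumr -sumrB; apply: ler_sum => k _.
  have := @exprn_1B_le R s k; rewrite s0 s1 => /(_ isT) H.
  have := mu_ge0 k; rewrite /f; set x := mu k; set e := (1 - s) ^+ k in H * => x0.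
  have := ler_wpM2l x0 H; lra.
have -> : \sum_(0 <= k < n) mu k * (1 - s) ^+ k =
    \sum_(0 <= k < n) mu k - \sum_(0 <= k < n) f k.
  by rewrite -sumrB; apply: eq_bigr => k _; rewrite /f; ring.
(* [K] and [n] may come in either order: between them, [f] is at most [mu]. *)
have gmono N N' (g : nat -> R) : (N <= N')%N -> (forall k, 0 <= g k) ->
    \sum_(0 <= k < N) g k <= \sum_(0 <= k < N') g k.
  by move=> h g0; rewrite (big_cat_nat (leq0n _) h)//= lerDl sumr_ge0.
have [Kn|/ltnW nK] := leqP K n.
  have := gmono _ _ f Kn f0; have := partial_sum_offspring_le1 n.
  have : s * (s * Q) <= s * (A - m') by rewrite ler_wpM2l//; nra.
  by nra.
have H : \sum_(n <= k < K) f k <= \sum_(n <= k < K) mu k.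
  by apply: ler_sum => k _; rewrite ler_piMr// lerBlDr lerDl exprn_ge0//; lra.
have := partial_sum_offspring_le1 K; rewrite (big_cat_nat (leq0n _) nK)//=.
move: fK; rewrite (big_cat_nat (leq0n _) nK)//=.
have : s * (s * Q) <= s * (A - m') by rewrite ler_wpM2l//; nra.
by nra.
Qed.
End Pgf.

(** * One step of the random walk *)

Section Walk.
Variables (R : realType) (pi : int -> R) (b : nat).

(** The jumps of size at most [b], enumerated so that sums over them are finite. *)
Definition jump (i : 'I_(b.*2.+1)) : int := i%:Z - b%:Z.

Definition step (g : int -> R) (y : int) : R :=
  \sum_(i < b.*2.+1) pi (jump i) * g (y + jump i).

(** Total mass at most 1 is enough for the upper bounds on avoidance
    probabilities, and is what the law of a bounded increment gives directly. *)
Definition jump_law : Prop :=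
  [/\ forall z, 0 <= pi z,
      forall z, (b < `|z|)%N -> pi z = 0 &
      \sum_(i < b.*2.+1) pi (jump i) <= 1].

Hypothesis hpi : jump_law.

Let pi_ge0 z : 0 <= pi z. Proof. by case: hpi. Qed.

Lemma jump_bound i : (`|jump i| <= b)%N.
Proof. by rewrite /jump; have := ltn_ord i; lia. Qed.

Lemma ler_step g g' y :
  (forall z, (`|z - y| <= b)%N -> g z <= g' z) -> step g y <= step g' y.
Proof.
move=> gg'; apply: ler_sum => i _; rewrite ler_wpM2l// gg'//.
by rewrite addrC addKr jump_bound.
Qed.

Lemma step_le c g y : 0 <= c ->
  (forall z, (`|z - y| <= b)%N -> g z <= c) -> step g y <= c.
Proof.
move=> c0 gc; apply: (@le_trans _ _ (step (fun=> c) y)); first exact: ler_step.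
by rewrite /step -mulr_suml; case: hpi => _ _ p1; rewrite ler_piMl.
Qed.

Lemma step_ge0 g y : (forall z, 0 <= g z) -> 0 <= step g y.
Proof. by move=> g0; apply: sumr_ge0 => i _; rewrite mulr_ge0. Qed.

Lemma step01 g y : (forall z, 0 <= g z <= 1) -> 0 <= step g y <= 1.
Proof.
move=> g01; rewrite step_ge0 ?step_le// => z; first by move=> _; case/andP: (g01 z).
by case/andP: (g01 z).
Qed.

Lemma stepZ c g y : step (fun z => c * g z) y = c * step g y.
Proof. by rewrite /step mulr_sumr; apply: eq_bigr => i _; rewrite mulrCA. Qed.

Lemma step_compl g y : step (fun z => 1 - g z) y <= 1 - step g y.
Proof.
rewrite /step; under eq_bigr do rewrite mulrBr mulr1.
by rewrite sumrB lerD2r; case: hpi.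
Qed.

Lemma step_shift c g y : step (fun z => g (z + c)) y = step g (y + c).
Proof. by apply: eq_bigr => i _; rewrite addrAC. Qed.

Lemma esum_step g y : (forall z, 0 <= g z) ->
  (\esum_(z in [set: int]) (pi (z - y) * g z)%:E = (step g y)%:E)%E.
Proof.
move=> g0; have a0 z : 0 <= pi (z - y) * g z by rewrite mulr_ge0.
pose e (n : nat) : int := y + (n%:Z - b%:Z).
have einj : set_inj `I_(b.*2.+1) e by move=> i j _ _; rewrite /e; lia.
transitivity (\esum_(z in e @` `I_(b.*2.+1)) (pi (z - y) * g z)%:E)%E.
  rewrite [RHS]esum_mkcond; apply: eq_esum => z _; case: ifPn => //.
  rewrite notin_setE/= => H; case: hpi => _ -> //; first by rewrite mul0r.
  rewrite ltnNge; apply/negP => zb; apply: H.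
  by exists (absz (z - y + b%:Z)); rewrite /e/=; lia.
rewrite esum_image// esum_fset//; last by move=> i _; rewrite lee_fin.
rewrite -fsbig_ord sumEFin; congr (_%:E); apply: eq_bigr => i _.
by rewrite /jump /e [y + _]addrC addrK.
Qed.

Notation pn := (nstep (fun x y => pi (y - x))).

Lemma nstep_ge0 n x y : 0 <= pn n x y.
Proof.
elim: n x => [|n IH] x /=; first by [].
apply: fine_ge0; apply: esum_ge0 => z _.
by rewrite lee_fin mulr_ge0.
Qed.

Lemma nstepS n x y : pn n.+1 x y = step (fun z => pn n z y) x.
Proof. by rewrite /= esum_step// => z; exact: nstep_ge0. Qed.

Lemma nstep_le1 n x y : pn n x y <= 1.
Proof.
elim: n x => [|n IH] x; first by rewrite /=; case: eqP.
by rewrite nstepS step_le.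
Qed.

Lemma nstep_shift n c x y : pn n (x + c) (y + c) = pn n x y.
Proof.
elim: n x => [|n IH] x; first by rewrite /= (inj_eq (addIr c)).
by rewrite !nstepS -step_shift; apply: eq_bigr => i _; rewrite IH.
Qed.

(** Only the paths that are at [y] at time [n] are kept. *)
Lemma nstepD n k x y z : pn n x y * pn k y z <= pn (n + k) x z.
Proof.
elim: n x => [|n IH] x.
  rewrite add0n /=; case: eqP => [->|_]; first by rewrite mul1r.
  by rewrite mul0r nstep_ge0.
rewrite addSn !nstepS mulrC -stepZ.
by apply: ler_step => t _; rewrite mulrC.
Qed.

Lemma nstep_muln n k x : pn n x x ^+ k <= pn (k * n) x x.
Proof.
elim: k => [|k IH]; first by rewrite /= expr0 eqxx.
rewrite exprS mulSn; apply: le_trans (nstepD _ _ _ x _).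
by rewrite ler_wpM2l ?nstep_ge0.
Qed.

End Walk.

(** * Survival functions and avoidance of a site *)

Section Survival.
Variables (R : realType) (pi : int -> R) (b : nat) (mu : nat -> R).

(** [survive Ds y] is the probability, for the process started at [y], that
    each generation [i] lies in the set of sites [Ds_i]. By the branching
    property the children of a particle succeed independently, whence the
    recursion through [pgf] and [step]. *)
Fixpoint survive (Ds : seq (pred int)) (y : int) : R :=
  if Ds is D :: Ds' then (D y)%:R * pgf mu (step pi b (survive Ds') y) else 1.

Definition avoid (a : int) (n : nat) : int -> R := survive (nseq n (predC1 a : pred int)).

Hypotheses (hpi : jump_law pi b) (hmu : offspring_distribution mu).

Lemma survive01 Ds y : 0 <= survive Ds y <= 1.
Proof.
elim: Ds y => [|D Ds IH] y /=; first by rewrite ler01 lexx.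
have s01 := step01 hpi y IH.
by case: (D y); rewrite ?mul0r ?mul1r ?lexx ?ler01// pgf_ge0// pgf_le1.
Qed.

Lemma avoid01 a n y : 0 <= avoid a n y <= 1.
Proof. exact: survive01. Qed.

Lemma avoidS a n y :
  avoid a n.+1 y = (y != a)%:R * pgf mu (step pi b (avoid a n) y).
Proof. by []. Qed.

Lemma avoidS_le a n y : avoid a n.+1 y <= pgf mu (step pi b (avoid a n) y).
Proof. by rewrite avoidS ler_piMl ?lern1 ?leq_b1 ?pgf_ge0 ?step01// => ?; exact: survive01. Qed.

Lemma ler_pgf_step g g' y : (forall z, 0 <= g z) -> (forall z, 0 <= g' z <= 1) ->
  (forall z, (`|z - y| <= b)%N -> g z <= g' z) ->
  pgf mu (step pi b g y) <= pgf mu (step pi b g' y).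
Proof.
move=> g0 g'01 gg'; rewrite ler_pgf//; first exact: step_ge0.
  exact: ler_step.
by case/andP: (step01 hpi y g'01).
Qed.

Lemma avoid_succ_le a n y : avoid a n.+1 y <= avoid a n y.
Proof.
elim: n y => [|n IH] y; first by case/andP: (avoid01 a 1 y).
rewrite avoidS [leRHS]avoidS ler_wpM2l// ler_pgf_step// => z.
  by case/andP: (avoid01 a n.+1 z).
exact: avoid01.
Qed.

Lemma avoid_le a n n' y : (n <= n')%N -> avoid a n' y <= avoid a n y.
Proof.
move=> /subnK <-; elim: (n' - n)%N => [//|k IH].
by apply: le_trans IH; rewrite addSn avoid_succ_le.
Qed.

(** Restarting after [k] generations: the particles alive then are within
    [k * b] of the start and there is at least one of them, so the failure of
    the first [k] generations and a later failure bounded by [M] multiply. *)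
Lemma avoid_split a k n M y : 0 <= M <= 1 ->
  (forall z, (`|z - y| <= k * b)%N -> avoid a n z <= M) ->
  avoid a (k + n) y <= M * avoid a k y.
Proof.
move=> M01; elim: k y => [|k IH] y Hz; first by rewrite mulr1 Hz// subrr.
rewrite addSn !avoidS mulrCA ler_wpM2l//.
have hM z : 0 <= M * avoid a k z <= 1.
  case/andP: M01 => M0 M1; case/andP: (avoid01 a k z) => h0 h1.
  by rewrite mulr_ge0// mulr_ile1.
apply: (@le_trans _ _ (pgf mu (step pi b (fun z => M * avoid a k z) y))).
  apply: ler_pgf_step => // z; first by case/andP: (avoid01 a (k + n) z).
  by move=> zy; apply: IH => t tz; apply: Hz; lia.
by rewrite stepZ pgf_scale// step01// => z; exact: avoid01.
Qed.

(** Growth of the population makes failure rare: each generation applies [pgf]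
    once more, and on [[0, c]] this contracts by [kappa]. In [k] generations the
    particles spread over a distance [k * b] only. *)
Lemma avoid_boost a k n y c kappa : 0 <= c <= 1 -> 0 <= kappa <= 1 ->
  (forall s, 0 <= s <= c -> pgf mu s <= kappa * s) ->
  (forall z, (`|z - y| <= k * b)%N -> avoid a n z <= c) ->
  avoid a (k + n) y <= kappa ^+ k * c.
Proof.
move=> /andP[c0 c1] /andP[k0 k1] Hk; elim: k y => [|k IH] y Hz.
  by rewrite mul1r Hz// subrr.
have kc0 : 0 <= kappa ^+ k * c by rewrite mulr_ge0 ?exprn_ge0.
have kcc : kappa ^+ k * c <= c by rewrite ler_piMl// exprn_ile1.
apply: le_trans (avoidS_le _ _ _) _; rewrite exprS -mulrA.
apply: le_trans (Hk _ _); last by rewrite kc0.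
rewrite ler_pgf ?(le_trans kcc)//.
  by apply: step_ge0 => // z; case/andP: (avoid01 a (k + n) z).
by apply: step_le => // z zy; apply: IH => t tz; apply: Hz; lia.
Qed.

(** As [pgf s <= s], unconstrained generations preserve an upper bound; they
    only widen the window on which it is required. *)
Lemma survive_free n Ds c y : 0 <= c <= 1 ->
  (forall z, (`|z - y| <= n * b)%N -> survive Ds z <= c) ->
  survive (nseq n (xpredT : pred int) ++ Ds) y <= c.
Proof.
move=> /andP[c0 c1]; elim: n y => [|n IH] y Hz; first by rewrite Hz// subrr.
rewrite /= mul1r; apply: le_trans (pgf_le hmu _) _.
  by apply: step01 => // z; exact: survive01.
by apply: step_le => // z zy; apply: IH => t tz; apply: Hz; lia.
Qed.

Variables (m' s0 : R).
Hypothesis near1 : forall s, 0 <= s <= s0 -> pgf mu (1 - s) <= 1 - m' * s.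
Hypotheses (m'_gt1 : 1 < m') (hs0 : 0 < s0 <= 1).

Notation pn := (nstep (fun x y => pi (y - x))).

(** As long as hitting probabilities stay below [s0], one generation multiplies
    them by at least [m'] besides averaging them by [step]: a hitting
    probability [q] at [y] becomes [q * m' ^+ j * pn j x y] at [x] after [j]
    generations, as for a branching process of mean [m']. *)
Lemma avoid_spread a n J j q x y : (j <= J)%N -> 0 <= q -> q * m' ^+ J <= s0 ->
  avoid a n y <= 1 - q -> avoid a (j + n) x <= 1 - q * m' ^+ j * pn j x y.
Proof.
move=> + q0 qJ Hy; elim: j x => [|j IH] x jJ.
  rewrite mulr1 add0n /=; case: eqP => [->|_]; first by rewrite mulr1.
  by rewrite mulr0 subr0; case/andP: (avoid01 a n x).
have m'0 : 0 <= m' by rewrite ltW// (lt_trans ltr01).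
have qj0 : 0 <= q * m' ^+ j by rewrite mulr_ge0 ?exprn_ge0.
have qjs : q * m' ^+ j <= s0.
  by apply: le_trans qJ; rewrite ler_wpM2l// ler_weXn2l ?(ltW m'_gt1)// ltnW.
set s := q * m' ^+ j * step pi b (fun z => pn j z y) x.
have s_le : 0 <= s <= s0.
  have n0 : 0 <= step pi b (fun z => pn j z y) x.
    by apply: step_ge0 => // z; exact: (nstep_ge0 hpi).
  rewrite mulr_ge0//= (le_trans _ qjs)// ler_piMr//.
  by apply: step_le => // z _; exact: (nstep_le1 hpi).
have -> : q * m' ^+ j.+1 * pn j.+1 x y = m' * s.
  by rewrite (nstepS hpi) exprSr /s; ring.
apply: le_trans (avoidS_le _ _ _) _; apply: le_trans (near1 s_le).
case/andP: s_le => s_ge0 s_les0; case/andP: hs0 => _ s01.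
apply: ler_pgf => //.
- by apply: step_ge0 => // z; case/andP: (avoid01 a (j + n) z).
- rewrite /s -stepZ; apply: le_trans (step_compl hpi _ _).
  by apply: ler_step => // z _; apply: IH; exact: ltnW.
- by rewrite lerBlDr lerDl.
Qed.

(** Along the lattice the walk carries a supercritical process: moving one site
    to either side costs a bounded number of generations and does not decrease
    the hitting probability [q]. Hence the hitting probability is at least [q]
    from any distance, in a time linear in that distance. *)
Lemma avoid_hit N1 N2 : 1 <= m' ^+ N1 * pn N1 0 1 ->
  1 <= m' ^+ N2 * pn N2 0 (-1) ->
  exists2 q : R, 0 < q < 1 & q <= s0 /\
    forall a L x, (`|x - a| <= L)%N -> avoid a (1 + (N1 + N2) * L) x <= 1 - q.
Proof.
move=> H1 H2; set J := (N1 + N2)%N; case/andP: hs0 => s0_gt0 s0_le1.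
have mJ : 1 <= m' ^+ J by rewrite exprn_ege1// ltW.
have mJ0 : 0 < m' ^+ J by lra.
(* Division by [m' ^+ J] keeps [q * m' ^+ j] in the range of [near1] for the
   whole move, and the factor 2 makes [q < 1]. *)
pose q := s0 / m' ^+ J / 2.
have qJ : q * m' ^+ J <= s0 by rewrite /q mulrAC divfK ?gt_eqF//; lra.
have q0 : 0 < q by rewrite !divr_gt0.
have qs : q <= s0 / 2 by rewrite ler_pM2r// ler_pdivrMr// ler_peMr// ltW.
exists q; first by lra.
split; first by lra.
move=> a; elim=> [|L IH] x xL.
  have -> : x = a by clear -xL; lia.
  by rewrite muln0 /avoid /= eqxx mul0r; lra.
have [->|xa] := eqVneq x a.
  apply: le_trans (IH a _); last by rewrite subrr.
  by apply: avoid_le; clear; lia.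
suff [j [y [jJ yL Hj]]] : exists j y, [/\ (j <= J)%N, (`|y - a| <= L)%N &
    1 <= m' ^+ j * pn j x y].
  apply: (@le_trans _ _ (avoid a (j + (1 + J * L)) x)).
    by apply: avoid_le; clear -jJ; lia.
  apply: le_trans (avoid_spread _ jJ (ltW q0) qJ (IH y yL)) _.
  by rewrite lerD2l lerN2 -mulrA ler_peMr// ltW.
have [xa'|xa'] := ltP x a.
  exists N1, (x + 1); split; [by rewrite ?leq_addr ?leq_addl|clear -xa xa' xL; lia|].
  by rewrite -[x in pn _ x _]add0r [x + 1]addrC (nstep_shift hpi).
exists N2, (x - 1); split; [by rewrite ?leq_addr ?leq_addl|clear -xa xa' xL; lia|].
by rewrite -[x in pn _ x _]add0r [x - 1]addrC (nstep_shift hpi).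
Qed.

(** At scale [L] an attempt to reach [a] takes [D * L] generations, fails with
    probability [kappa ^+ k], and if it fails leaves particles at scale [A * L].
    The exponent [k] is chosen after [D] and [A], so that one attempt gains at
    least the factor [4 * A ^+ 2] that the larger scale and the elapsed time
    cost in the inductive bound. *)
Lemma avoid_quadratic N1 N2 : 1 <= m' ^+ N1 * pn N1 0 1 ->
  1 <= m' ^+ N2 * pn N2 0 (-1) ->
  exists C : R, exists L0 : nat, 0 <= C /\ forall a L n y, (L0 <= L)%N ->
    (`|y - a| <= L)%N -> avoid a n y * n%:R ^+ 2 <= C * L%:R ^+ 2.
Proof.
move=> H1 H2; have [q /andP[q0 q1] [qs hit]] := avoid_hit H1 H2.
set N := (N1 + N2)%N in hit.
pose c := 1 - q; pose kappa := pgf mu c / c.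
have c0 : 0 < c by rewrite /c; lra.
have c01 : 0 <= c <= 1 by rewrite /c; lra.
have Hc : pgf mu c <= 1 - m' * q by apply: near1; rewrite qs (ltW q0).
(* Here [1 < m'] enters: [pgf c <= 1 - m' * q < 1 - q = c]. *)
have k1 : kappa < 1.
  rewrite ltr_pdivrMr// mul1r; apply: le_lt_trans Hc _.
  by rewrite ltrD2l ltrN2 ltr_pMl.
have k0 : 0 <= kappa by rewrite divr_ge0 ?pgf_ge0// ltW.
have Hk s : 0 <= s <= c -> pgf mu s <= kappa * s.
  move=> /andP[s_ge0 sc]; rewrite -[X in pgf _ X](@divfK _ c) ?gt_eqF//.
  apply: le_trans (pgf_scale hmu _ _) _ => //.
    by apply/andP; split; rewrite ?ler_pdivrMr ?mul1r// divr_ge0// ltW.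
  by have -> : kappa * s = s / c * pgf mu c by rewrite /kappa; ring.
pose D := (N.*2 + 2)%N; pose A := (1 + D * b)%N.
have [k Hkk] : exists k, kappa ^+ k * (4 * A%:R ^+ 2) <= 1.
  have Y0 : 0 < (4 * A%:R ^+ 2 : R)^-1.
    by rewrite invr_gt0 mulr_gt0// exprn_gt0// ltr0n.
  have : (fun k => kappa ^+ k) @ \oo --> (0 : R).
    by apply: cvg_expr; rewrite ger0_norm.
  move=> /cvgr_lt /(_ _ Y0) [k _ Hk']; exists k.
  move: (Hk' k (leqnn k)) => /= /ltW.
  by rewrite -[_^-1]mul1r ler_pdivlMr ?mulr_gt0 ?exprn_gt0 ?ltr0n.
(* Above [L0], the [k] generations of growth and the distance [k * b] covered
   meanwhile are absorbed in the linear time [D * L]. *)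
pose L0 := (k + k * b + 1)%N.
have small a L y : (L0 <= L)%N -> (`|y - a| <= L)%N ->
    avoid a (D * L) y <= kappa ^+ k.
  move=> L0L yL.
  apply: (@le_trans _ _ (avoid a (k + (1 + N * (L + k * b))) y)).
    apply: avoid_le; move: L0L; rewrite /D /L0; clear; nia.
  apply: le_trans (@avoid_boost a k _ y c kappa c01 _ Hk _) _.
  - by rewrite k0 ltW.
  - by move=> z zy; apply: hit; clear -zy yL; lia.
  - by rewrite ler_piMr ?exprn_ge0//; case/andP: c01.
have C0 : 0 <= 4 * D%:R ^+ 2 :> R by rewrite mulr_ge0 ?exprn_ge0.
exists (4 * D%:R ^+ 2), L0; split=> // a L n.
elim/ltn_ind: n L => n IH L y L0L yL.
have [nD|Dn] := leqP n (2 * D * L).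
  apply: (@le_trans _ _ (n%:R ^+ 2)).
    by rewrite ler_piMl ?exprn_ge0//; case/andP: (avoid01 a n y).
  have -> : 4 * D%:R ^+ 2 * L%:R ^+ 2 = (2 * D * L)%:R ^+ 2 :> R.
    by rewrite !natrM; ring.
  by rewrite lerXn2r ?nnegrE// ler_nat.
have DL0 : (0 < D * L)%N by move: L0L; rewrite /D /L0; clear; nia.
pose n' := (n - D * L)%N.
have n'n : (n' < n)%N by rewrite /n'; clear -DL0 Dn; lia.
have n'0 : 0 < n'%:R :> R by rewrite ltr0n /n'; clear -DL0 Dn; lia.
(* The minimum with 1 is there because [avoid_split] restarts with a
   probability. *)
pose M := Num.min 1 (4 * D%:R ^+ 2 * (A * L)%:R ^+ 2 / n'%:R ^+ 2 : R).
have M0 : 0 <= M.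
  by rewrite le_min ler01 divr_ge0 ?mulr_ge0 ?exprn_ge0.
have M01 : 0 <= M <= 1 by rewrite M0 ge_min lexx.
have HM z : (`|z - y| <= D * L * b)%N -> avoid a n' z <= M.
  move=> zy; rewrite le_min; case/andP: (avoid01 a n' z) => _ -> /=.
  rewrite ler_pdivlMr ?exprn_gt0//; apply: IH => //.
    by rewrite /A; clear -L0L; nia.
  by rewrite /A; clear -yL zy; nia.
have := avoid_split M01 HM; rewrite subnKC; last by clear -DL0 Dn; lia.
move=> Hs; have Hs' := le_trans Hs (ler_wpM2l M0 (small a L y L0L yL)).
have HM' : M * n'%:R ^+ 2 <= 4 * D%:R ^+ 2 * (A * L)%:R ^+ 2.
  by rewrite -ler_pdivlMr ?exprn_gt0// ge_min lexx orbT.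
have nn' : n%:R ^+ 2 <= 4 * n'%:R ^+ 2 :> R.
  have -> : 4 * n'%:R ^+ 2 = (2 * n')%:R ^+ 2 :> R by rewrite natrM; ring.
  by rewrite lerXn2r ?nnegrE// ler_nat /n'; clear -DL0 Dn; lia.
apply: le_trans (ler_wpM2r (exprn_ge0 _ (ler0n _ n)) Hs') _.
have kk0 : 0 <= kappa ^+ k by rewrite exprn_ge0.
apply: le_trans (ler_wpM2l _ nn') _; first by rewrite mulr_ge0.
have -> : M * kappa ^+ k * (4 * n'%:R ^+ 2) = 4 * kappa ^+ k * (M * n'%:R ^+ 2).
  by ring.
apply: le_trans (ler_wpM2l _ HM') _; first by rewrite mulr_ge0.
have -> : 4 * kappa ^+ k * (4 * D%:R ^+ 2 * (A * L)%:R ^+ 2) =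
  kappa ^+ k * (4 * A%:R ^+ 2) * (4 * D%:R ^+ 2 * L%:R ^+ 2).
  by rewrite natrM; ring.
by rewrite ler_piMl// mulr_ge0 ?exprn_ge0.
Qed.

End Survival.

(** * Supercritical displacements *)

Section UpperLimit.
Variables (R : realType) (u : nat -> R).
Hypothesis u01 : forall n, 0 <= u n <= 1.

Let u_bounded : bounded_fun u.
Proof.
exists 1; split; first exact: num_real.
move=> x x1 n _ /=; case/andP: (u01 n) => u0 u1.
by rewrite ger0_norm// (le_trans u1)// ltW.
Qed.

Let u_ub n : has_ubound (sdrop u n).
Proof. by exists 1 => _ [k _ <-]; case/andP: (u01 k). Qed.

Lemma limn_sup_lt_often r : r < limn_sup u ->
  forall n0, exists2 n, (n0 <= n)%N & r < u n.
Proof.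
move=> ru n0; apply: contrapT => H; move: ru; apply/negP; rewrite -leNgt.
rewrite limn_supE//; apply: (@le_trans _ _ (sups u n0)).
  by apply: ge_inf; [exact: bounded_fun_has_lbound_sups|exists n0].
apply: ge_sup; first by exists (u n0), n0 => /=.
move=> _ [n /= n0n <-]; rewrite leNgt; apply/negP => run.
by apply: H; exists n.
Qed.

Lemma limn_sup_gt_eventually r : limn_sup u < r ->
  exists n0, forall n, (n0 <= n)%N -> u n < r.
Proof.
rewrite limn_supE// => /inf_lt[]; first by exists (sups u 0%N), 0%N.
move=> _ [n0 _ <-] ur; exists n0 => n n0n.
by apply: le_lt_trans ur; apply: ub_le_sup => //; exists n.
Qed.

End UpperLimit.

Lemma geometric_gt (R : realType) (a e : R) n0 : 1 < a -> 0 < e ->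
  exists2 k, (n0 <= k)%N & forall n, (k <= n)%N -> 1 < e * a ^+ n.
Proof.
move=> a1 e0.
have a0 : 0 < a by rewrite (lt_trans ltr01).
have : (fun k => a^-1 ^+ k) @ \oo --> (0 : R).
  by apply: cvg_expr; rewrite ger0_norm ?invr_ge0 ?ltW// invf_lt1.
move=> /cvgr_lt /(_ _ e0) [k _ Hk]; exists (maxn n0 k); first exact: leq_maxl.
move=> n; rewrite geq_max => /andP[_ kn]; have /= := Hk n kn.
by rewrite exprVn -[_^-1]mul1r ltr_pdivrMr// exprn_gt0.
Qed.

Section SpectralRadius.
Variables (R : realType) (pi : int -> R) (b : nat).
Hypothesis hpi : jump_law pi b.

Notation p := (fun x y : int => pi (y - x)).
Notation pn := (nstep p).
Hypothesis hirr : irreducible p.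

Let u x y (n : nat) : R := pn n x y `^ (n%:R^-1).

Let u01 x y n : 0 <= u x y n <= 1.
Proof.
have r0 : 0 <= n%:R^-1 :> R by rewrite invr_ge0.
have -> : 1 = 1 `^ (n%:R^-1) :> R by rewrite powR1.
rewrite powR_ge0/=; apply: ge0_ler_powR; rewrite ?nnegrE//.
  exact: (nstep_ge0 hpi).
exact: (nstep_le1 hpi).
Qed.

Let uX x y n : (0 < n)%N -> u x y n ^+ n = pn n x y.
Proof.
move=> n0; rewrite -powR_mulrn ?powR_ge0// -powRrM mulVf ?pnatr_eq0 -?lt0n//.
by rewrite powRr1// (nstep_ge0 hpi).
Qed.

(** A loop through [x] of positive probability [c] and length [j] forces
    exponential decay no faster than [c ^+ k] along the times [k * j + i]. This
    matters because [1 / 0 = 0] in a field: a null spectral radius would turn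
    the supercriticality condition into [0 < m]. *)
Lemma spectral_radius_gt0 x y : 0 < spectral_radius p x y.
Proof.
have [n1 H1] := hirr x (x + 1); have [n2 H2] := hirr (x + 1) x.
have [i Hi] := hirr x y.
set j := (n1 + n2)%N; pose c := pn j x x.
have c0 : 0 < c by apply: lt_le_trans (nstepD hpi n1 n2 x (x + 1) x); rewrite mulr_gt0.
have c1 : c <= 1 by exact: (nstep_le1 hpi).
have j0 : (0 < j)%N.
  rewrite /j; case: n1 H1 {j c c0 c1} => //=.
  by rewrite -[x in x == _]addr0 (inj_eq (addrI x)) ltxx.
rewrite ltNge; apply/negP => rho0.
have [n0 Hn0] : exists n0, forall n, (n0 <= n)%N -> u x y n < c / 2.
  apply: limn_sup_gt_eventually => //; apply: le_lt_trans rho0 _.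
  by rewrite divr_gt0.
have [k kn0 Hk] := @geometric_gt R 2 (pn i x y) n0.+1 (ltr1n _ _) Hi.
have n_n0 : (n0 <= k * j + i)%N by nia.
have n_gt0 : (0 < k * j + i)%N by nia.
have := Hn0 _ n_n0; apply/negP; rewrite -leNgt.
rewrite -(@ler_pXn2r _ (k * j + i)%N) ?nnegrE//; last 2 first.
- by rewrite divr_ge0// ltW.
- by case/andP: (u01 x y (k * j + i)).
rewrite uX//; apply: le_trans (nstepD hpi _ _ _ x _).
apply: le_trans (ler_wpM2r (ltW Hi) (nstep_muln hpi _ _ _)).
rewrite -/c; apply: (@le_trans _ _ ((c / 2) ^+ k)).
  apply: ler_wiXn2l; [by rewrite divr_ge0// ltW|lra|nia].
rewrite expr_div_n ler_wpM2l ?exprn_ge0 ?ltW//.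
by have := Hk k (leqnn k); rewrite -[_^-1]mul1r ltr_pdivrMr// exprn_gt0.
Qed.

(** For infinitely many [n] the quantity [m' ^+ n * pn n x0 y0] exceeds
    [(m' * r) ^+ n] with [1 < m' * r]. Prolonging the path on both sides costs
    the constant factor [e], which the geometric growth absorbs. *)
Lemma supercritical_path m x0 y0 : 1 / spectral_radius p x0 y0 < m ->
  exists2 m', 0 < m' < m & forall x y, exists N, 1 < m' ^+ N * pn N x y.
Proof.
have rho0 := spectral_radius_gt0 x0 y0; set rho := spectral_radius p x0 y0 in rho0 *.
move=> /midf_lt []; move: (_ / 2) => m' m'1 m'm; 
have m'0 : 0 < m' by apply: lt_trans m'1; rewrite divr_gt0.
exists m' => [|x y]; first by rewrite m'0.
have r_rho : m'^-1 < rho by rewrite -[m'^-1]mul1r ltr_pdivrMr// -ltr_pdivrMl// mulrC.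
move: (midf_lt r_rho) => []; move: (_ / 2) => r r1 r_lt.
have mr : 1 < m' * r by rewrite -ltr_pdivrMl// mulr1.
have r0 : 0 < r by apply: lt_trans r1; rewrite invr_gt0.
have [i Hi] := hirr x x0; have [l Hl] := hirr y0 y.
pose e := m' ^+ i * pn i x x0 * (m' ^+ l * pn l y0 y).
have e0 : 0 < e by rewrite !mulr_gt0 ?exprn_gt0.
have [k k1 Hk] := geometric_gt 1 mr e0.
have [n kn run] := limn_sup_lt_often (u01 x0 y0) r_lt k.
have n0 : (0 < n)%N by exact: leq_trans kn.
have rn : r ^+ n <= pn n x0 y0.
  rewrite -uX//; apply: lerXn2r; rewrite ?nnegrE; [exact: ltW| |exact: ltW].
  by case/andP: (u01 x0 y0 n).
exists (i + (n + l))%N; apply: lt_le_trans (Hk n kn) _.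
have H := nstepD hpi i (n + l) x x0 y.
apply: le_trans (ler_wpM2l (exprn_ge0 _ (ltW m'0)) H).
have H' := ler_wpM2l (ltW Hi) (nstepD hpi n l x0 y0 y).
apply: le_trans (ler_wpM2l (exprn_ge0 _ (ltW m'0)) H').
rewrite /e !exprD exprMn.
set A := m' ^+ i; set B := m' ^+ l; set M := m' ^+ n.
have -> : A * (M * B) * (pn i x x0 * (pn n x0 y0 * pn l y0 y)) =
  A * pn i x x0 * (B * pn l y0 y) * (M * pn n x0 y0) by ring.
by rewrite ler_wpM2l ?(ltW e0)// ler_wpM2l// exprn_ge0// ltW.
Qed.

End SpectralRadius.

(** * Sums over generations *)

Section WordSums.
Variable R : realType.

Lemma esumZ_le (I : choiceType) (S : set I) (c : R) (a : I -> \bar R) : 0 <= c ->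
  (forall i, S i -> 0 <= a i)%E ->
  (\esum_(i in S) (c%:E * a i) <= c%:E * \esum_(i in S) a i)%E.
Proof.
move=> c0 a0; apply: ge_ereal_sup => _ [F [finF FS] <-].
rewrite fsbig_finite//= big_seq -ge0_sume_distrr; last first.
  by move=> i; rewrite in_fset_set// inE => /FS/a0.
rewrite -big_seq lee_wpmul2l ?lee_fin//; apply: esum_ge.
by exists F => //; rewrite fsbig_finite.
Qed.

(** A word of size [k.+1] is a letter and a word of size [k], so the sum
    factors into [k] equal sums over letters. *)
Lemma esum_fixed_size (a : int -> R) (A : R) k : 0 <= A -> (forall z, 0 <= a z) ->
  (\esum_(z in [set: int]) (a z)%:E <= A%:E)%E ->
  (\esum_(t in [set t : seq int | size t = k]) (\prod_(z <- t) a z)%:E <=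
    (A ^+ k)%:E)%E.
Proof.
move=> A0 a0 aA; have pa0 (t : seq int) : 0 <= \prod_(z <- t) a z by exact: prodr_ge0.
elim: k => [|k IH].
  rewrite (_ : [set _ | _] = [set [::]]); last by apply/seteqP; split=> [[]|_ ->].
  by rewrite esum_set1 ?big_nil ?expr0 ?lee_fin.
rewrite (reindex_esum ([set: int] `*`` (fun=> [set t : seq int | size t = k])) _
    (fun p => p.1 :: p.2)); last first.
  split=> [[z t] [_ /= <-]//|[z t] [z' t'] _ _ [-> ->]//|].
  by move=> [//|z t] [] <-; exists (z, t).
have -> : (fun p : int * seq int => (\prod_(z <- p.1 :: p.2) a z)%:E) =
    (fun p => (fun z t => (a z)%:E * (\prod_(z <- t) a z)%:E)%E p.1 p.2).
  by apply/funext => p; rewrite big_cons EFinM.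
rewrite -(@esum_esum _ _ _ _ (fun=> [set t : seq int | size t = k])
   (fun z t => (a z)%:E * (\prod_(z <- t) a z)%:E)%E); last first.
  by move=> z t _ _; rewrite mule_ge0 ?lee_fin.
apply: (@le_trans _ _ (\esum_(z in [set: int]) ((A ^+ k)%:E * (a z)%:E))%E).
  apply: le_esum => z _; apply: le_trans (esumZ_le _ _) _ => //.
    by move=> t _; rewrite lee_fin.
  by rewrite muleC lee_wpmul2r ?lee_fin.
apply: le_trans (esumZ_le _ _) _; rewrite ?exprn_ge0//.
  by move=> z _; rewrite lee_fin.
by rewrite exprSr EFinM lee_wpmul2l ?lee_fin ?exprn_ge0.
Qed.

Lemma esum_all_sizes (mu : nat -> R) (a : int -> R) (A : R) : (forall k, 0 <= mu k) ->
  0 <= A -> (forall z, 0 <= a z) ->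
  (\esum_(z in [set: int]) (a z)%:E <= A%:E)%E ->
  (\esum_(t in [set: seq int]) (mu (size t) * \prod_(z <- t) a z)%:E <=
    \sum_(0 <= k <oo) (mu k * A ^+ k)%:E)%E.
Proof.
move=> mu0 A0 a0 aA; have pa0 (t : seq int) : 0 <= \prod_(z <- t) a z by exact: prodr_ge0.
rewrite nneseries_esumT; last by move=> k; rewrite lee_fin mulr_ge0 ?exprn_ge0.
rewrite (reindex_esum ([set: nat] `*`` (fun k => [set t : seq int | size t = k])) _ snd);
    last first.
  split=> [//|[k t] [k' t'] /set_mem[_ /= <-] /set_mem[_ /= <-] -> //|].
  by move=> t _; exists (size t, t).
have -> : \esum_(i in [set: nat] `*`` (fun k => [set t : seq int | size t = k]))
      (mu (size i.2) * \prod_(z <- i.2) a z)%:E =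
    \esum_(k in [set: nat]) \esum_(t in [set t : seq int | size t = k])
      ((mu k)%:E * (\prod_(z <- t) a z)%:E)%E.
  rewrite (@esum_esum _ _ _ _ (fun k => [set t : seq int | size t = k])
   (fun k t => (mu k)%:E * (\prod_(z <- t) a z)%:E)%E); last first.
    by move=> k t _ _; rewrite mule_ge0 ?lee_fin.
  by apply: eq_esum => -[k t] [_ /= ->]; rewrite EFinM.
apply: le_esum => k _; apply: le_trans (esumZ_le _ _) _ => //.
  by move=> t _; rewrite lee_fin.
by rewrite EFinM lee_wpmul2l ?lee_fin// esum_fixed_size.
Qed.

(** Words with a marked cut correspond to pairs of words by concatenation. *)
Lemma esum_cuts (F H : seq int -> R) (cF cH : R) :
  (forall t, 0 <= F t) -> (forall t, 0 <= H t) -> 0 <= cF -> 0 <= cH ->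
  (\esum_(t in [set: seq int]) (F t)%:E <= cF%:E)%E ->
  (\esum_(t in [set: seq int]) (H t)%:E <= cH%:E)%E ->
  (\esum_(t in [set: seq int])
     (\sum_(k < (size t).+1) F (take k t) * H (drop k t))%:E <= (cF * cH)%:E)%E.
Proof.
move=> F0 H0 cF0 cH0 hF hH.
pose G (t : seq int) k := (F (take k t) * H (drop k t))%:E.
have -> : \esum_(t in [set: seq int])
     (\sum_(k < (size t).+1) F (take k t) * H (drop k t))%:E =
   \esum_(t in [set: seq int]) \esum_(k in `I_(size t).+1) G t k.
  apply: eq_esum => t _; rewrite -sumEFin esum_fset//; last first.
    by move=> k _; rewrite lee_fin mulr_ge0.
  by rewrite -fsbig_ord.
rewrite (@esum_esum _ _ _ _ (fun t : seq int => `I_(size t).+1)); last first.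
  by move=> t k _ _; rewrite lee_fin mulr_ge0.
rewrite (reindex_esum ([set: seq int] `*`` (fun=> [set: seq int])) _
    (fun p => (p.1 ++ p.2, size p.1))); last first.
  split=> [[s t] _ /=|[s t] [s' t'] _ _ /= [e1 e2]|[t k] [_ /= kt]].
  - by split=> //=; rewrite size_cat ltnS leq_addr.
  - have := congr1 (take (size s)) e1; rewrite take_size_cat// e2 take_size_cat// => ->.
    by have := congr1 (drop (size s)) e1; rewrite drop_size_cat// e2 drop_size_cat// => ->.
  - by exists (take k t, drop k t) => //=; rewrite cat_take_drop size_takel.
have -> : \esum_(i in [set: seq int] `*`` (fun=> [set: seq int]))
      G (i.1 ++ i.2, size i.1).1 (i.1 ++ i.2, size i.1).2 =
    \esum_(s in [set: seq int]) \esum_(t in [set: seq int]) ((F s)%:E * (H t)%:E)%E.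
  rewrite (@esum_esum _ _ _ _ (fun=> [set: seq int])
    (fun s t => (F s)%:E * (H t)%:E)%E); last first.
    by move=> s t _ _; rewrite mule_ge0 ?lee_fin.
  apply: eq_esum => -[s t] _.
  by rewrite /G /= take_size_cat// drop_size_cat// EFinM.
apply: (@le_trans _ _ (\esum_(s in [set: seq int]) (cH%:E * (F s)%:E))%E).
  apply: le_esum => s _; apply: le_trans (esumZ_le _ _) _ => //.
    by move=> t _; rewrite lee_fin.
  by rewrite muleC lee_wpmul2r ?lee_fin.
apply: le_trans (esumZ_le _ _) _ => //; first by move=> s _; rewrite lee_fin.
by rewrite mulrC EFinM lee_wpmul2l ?lee_fin.
Qed.

End WordSums.

Section GenerationStep.
Variables (R : realType) (pi : int -> R) (b : nat) (mu : nat -> R).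
Hypotheses (hpi : jump_law pi b) (hmu : offspring_distribution mu).

Notation p := (fun x y : int => pi (y - x)).

Let pi0 z : 0 <= pi z. Proof. by case: hpi. Qed.
Let mu0 k : 0 <= mu k. Proof. by case: hmu. Qed.

Lemma children_ge0 y t : 0 <= children p mu y t.
Proof. by rewrite mulr_ge0// prodr_ge0. Qed.

Lemma generation_step_ge0 s t : 0 <= generation_step p mu s t.
Proof.
elim: s t => [|y s IH] t //=; apply: sumr_ge0 => k _.
by rewrite mulr_ge0// children_ge0.
Qed.

(** The branching property: the next generation is the concatenation of
    independent families, so the expectation of a multiplicative function of it
    factors over the present particles. *)
Lemma generation_step_prod s g : (forall z, 0 <= g z <= 1) ->
  (\esum_(t in [set: seq int]) (generation_step p mu s t * \prod_(z <- t) g z)%:E <=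
   (\prod_(y <- s) pgf mu (step pi b g y))%:E)%E.
Proof.
move=> g01; have g0 z : 0 <= g z by case/andP: (g01 z).
have pg0 (t : seq int) : 0 <= \prod_(z <- t) g z by exact: prodr_ge0.
have Pg01 y := step01 hpi y g01.
elim: s => [|y s IH].
  rewrite big_nil [leLHS](_ : _ = \esum_(t in [set [::] : seq int]) 1%E).
    by rewrite esum_set1.
  rewrite [RHS]esum_mkcond; apply: eq_esum => t _ /=; case: eqP => [->|t0].
    by rewrite mem_set// big_nil mul1r.
  by rewrite memNset// mul0r.
rewrite big_cons.
pose F t := children p mu y t * \prod_(z <- t) g z.
pose H t := generation_step p mu s t * \prod_(z <- t) g z.
rewrite (_ : (fun t => _) =
    fun t => (\sum_(k < (size t).+1) F (take k t) * H (drop k t))%:E); last first.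
  apply/funext => t /=; congr (_%:E); rewrite mulr_suml; apply: eq_bigr => k _.
  by rewrite -[in X in _ * X = _](cat_take_drop k t) big_cat /F /H mulrACA.
apply: esum_cuts => //.
- by move=> t; rewrite mulr_ge0// children_ge0.
- by move=> t; rewrite mulr_ge0// generation_step_ge0.
- exact: pgf_ge0.
- by apply: prodr_ge0 => z _; exact: pgf_ge0.
rewrite -(pgfE hmu)// /F.
rewrite (_ : (fun t => _) =
    fun t => (mu (size t) * \prod_(z <- t) (pi (z - y) * g z))%:E); last first.
  by apply/funext => t; rewrite big_split /= mulrA.
apply: esum_all_sizes => //; first by case/andP: (Pg01 y).
  by move=> z; rewrite mulr_ge0.
by rewrite (esum_step hpi).
Qed.

End GenerationStep.

(** * From the process to survival functions *)

Section Process.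
Variables (R : realType) (pi : int -> R) (b : nat) (mu : nat -> R).
Hypotheses (hpi : jump_law pi b) (hmu : offspring_distribution mu).

Notation p := (fun x y : int => pi (y - x)).

Variables (d : measure_display) (T : measurableType d).
Variables (PP : int -> probability T R) (Y : nat -> T -> seq int).
Hypothesis hbrw : branching_random_walk p mu PP Y.

Let mY n (B : set (seq int)) : measurable (Y n @^-1` B).
Proof. by case: hbrw. Qed.

(** Defined by recursion on [Ds], so as to follow the recursion of [survive]. *)
Fixpoint confined (Ds : seq (pred int)) (n : nat) : set T :=
  if Ds is D :: Ds' then Y n @^-1` [set s | all D s] `&` confined Ds' n.+1
  else setT.

Lemma measurable_confined Ds n : measurable (confined Ds n).
Proof.
by elim: Ds n => [|D Ds IH] n //=; exact: measurableI.
Qed.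

Definition cylinder (n : nat) (s : nat -> seq int) : set T :=
  [set w | forall i, (i <= n)%N -> Y i w = s i].

Lemma cylinderE n s : cylinder n s = \bigcap_(i in `I_n.+1) (Y i @^-1` [set s i]).
Proof. by apply/seteqP; split=> w /= H i; have := H i; rewrite /= ltnS. Qed.

Lemma measurable_cylinder n s : measurable (cylinder n s).
Proof. by rewrite cylinderE; apply: bigcap_measurable => //; exists 0%N. Qed.

Lemma measure_le_esum (P : probability T R) (f : T -> seq int) (E : set T) :
  measurable E -> (forall B : set (seq int), measurable (f @^-1` B)) ->
  (P E <= \esum_(t in [set: seq int]) P (E `&` f @^-1` [set t]))%E.
Proof.
move=> mE mf.
pose F n := if pickle_inv n is Some t then E `&` f @^-1` [set t] else set0.
have mF n : measurable (F n).
  by rewrite /F; case: pickle_inv => [t|//]; exact: measurableI.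
apply: (@le_trans _ _ (\sum_(0 <= n <oo) P (F n))%E).
  apply: measure_sigma_subadditive => // w Ew.
  by exists (pickle (f w)) => //; rewrite /F pickleK_inv.
rewrite nneseries_esumT; last by move=> n; exact: measure_ge0.
have -> : \esum_(t in [set: seq int]) P (E `&` f @^-1` [set t]) =
    \esum_(n in (@pickle (seq int)) @` setT) P (F n).
  rewrite esum_image; last by move=> s t _ _; exact: (pcan_inj pickleK).
  by apply: eq_esum => t _; rewrite /F pickleK_inv.
rewrite [leRHS]esum_mkcond; apply: le_esum => n _.
case: ifPn => //; rewrite notin_setE => Hn.
rewrite (_ : F n = set0) ?measure0// /F.
case E' : pickle_inv => [t|//]; exfalso; apply: Hn; exists t => //.
by have := @pickle_invK (seq int) n; rewrite E'.
Qed.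

(** The Markov property, by induction on the constraints: the event is split
    according to the next generation [t], and the sum over [t] is evaluated by
    the branching property. *)
Lemma cylinder_confined x Ds n s :
  (PP x (cylinder n s `&` confined Ds n) <=
   PP x (cylinder n s) * (\prod_(y <- s n) survive pi b mu Ds y)%:E)%E.
Proof.
elim: Ds n s => [|D Ds IH] n s.
  by rewrite /= setIT big1 ?mule1.
have surv0 y : 0 <= survive pi b mu Ds y by case/andP: (survive01 hpi hmu Ds y).
have surv0' y : 0 <= survive pi b mu (D :: Ds) y.
  by case/andP: (survive01 hpi hmu (D :: Ds) y).
have [Ds_n|Ds_n] := boolP (all D (s n)); last first.
  rewrite (_ : _ `&` _ = set0) ?measure0.
    by rewrite mule_ge0 ?measure_ge0// lee_fin prodr_ge0.
  apply/seteqP; split=> // w [] /(_ n (leqnn n)) Yn [] /=.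
  by rewrite Yn (negPf Ds_n).
pose st t i := if (i <= n)%N then s i else t.
have mC : measurable (cylinder n s `&` confined (D :: Ds) n).
  by apply: measurableI; [exact: measurable_cylinder|exact: measurable_confined].
apply: le_trans (measure_le_esum _ mC (@mY n.+1)) _.
have cyl m r : PP x (cylinder m r) = ((r 0%N == [:: x])%:R *
    \prod_(i < m) generation_step p mu (r i) (r i.+1))%:E.
  by case: hbrw => _; exact.
have g0 := generation_step_ge0 hpi hmu.
set c : R := (s 0%N == [:: x])%:R * \prod_(i < n) generation_step p mu (s i) (s i.+1).
have c0 : 0 <= c by rewrite mulr_ge0// prodr_ge0.
apply: (@le_trans _ _ (\esum_(t in [set: seq int]) (c%:E *
    (generation_step p mu (s n) t * \prod_(z <- t) survive pi b mu Ds z)%:E))%E).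
  apply: le_esum => t _.
  apply: (@le_trans _ _ (PP x (cylinder n.+1 (st t) `&` confined Ds n.+1))).
    apply: le_measure; rewrite ?inE.
    - exact: measurableI.
    - by apply: measurableI; [exact: measurable_cylinder|exact: measurable_confined].
    - move=> w [[Hs /= [_ Hc]] Yt]; split=> // i; rewrite /st.
      by case: ifPn => [/Hs//|]; rewrite -ltnNge => ni ni'; rewrite (_ : i = n.+1)//; lia.
  apply: le_trans (IH _ _) _; rewrite cyl -!EFinM lee_fin mulrA /st /= ltnn.
  rewrite ler_wpM2r ?prodr_ge0// big_ord_recr /= leqnn ltnn mulrA ler_wpM2r//.
  rewrite le_eqVlt; apply/orP; left; apply/eqP; congr (_ * _).
  by apply: eq_bigr => i _; rewrite (ltnW (ltn_ord i)) ltn_ord.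
apply: le_trans (esumZ_le c0 _) _.
  by move=> t _; rewrite lee_fin mulr_ge0// prodr_ge0.
rewrite cyl -/c lee_wpmul2l ?lee_fin//.
apply: le_trans (generation_step_prod hpi hmu _ _) _; first exact: survive01.
rewrite lee_fin le_eqVlt; apply/orP; left; apply/eqP.
rewrite big_seq [RHS]big_seq; apply: eq_bigr => y ys /=.
by rewrite (allP Ds_n y ys) mul1r.
Qed.

Lemma confined_le x Ds :
  (PP x (confined Ds 0) <= (survive pi b mu Ds x)%:E)%E.
Proof.
pose s (i : nat) := [:: x].
have mC := @measurable_confined Ds 0.
have ms := measurable_cylinder 0 s.
have Ps : PP x (cylinder 0 s) = 1%E.
  case: hbrw => _ ->; by rewrite big_ord0 eqxx mulr1.
apply: (@le_trans _ _ (PP x ((cylinder 0 s `&` confined Ds 0) `|` ~` cylinder 0 s))).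
  apply: le_measure; rewrite ?inE//.
    by apply: measurableU; [exact: measurableI|exact: measurableC].
  by move=> w Cw; have [cw|cw] := pselect (cylinder 0 s w); [left|right].
apply: le_trans (measureU2 _ _ _) _; [exact: measurableI|exact: measurableC|].
have Ps' : PP x (~` cylinder 0 s) = 0%E by rewrite probability_setC// Ps subee.
rewrite [leLHS](_ : _ = PP x (cylinder 0 s `&` confined Ds 0)); last first.
  by rewrite [X in (_ + X)%E]Ps' adde0.
 apply: le_trans (cylinder_confined _ _ _ _) _.
by rewrite Ps mul1e /s big_seq1.
Qed.

Definition unvisited (a : int) (n k : nat) : set T :=
  [set w | forall i, (n <= i < n + k)%N -> a \notin Y i w].

Lemma unvisitedE a n k : unvisited a n k =
  \bigcap_(i in [set i | (n <= i < n + k)%N]) (Y i @^-1` [set s : seq int | a \notin s]).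
Proof. by []. Qed.

Lemma measurable_unvisited a n k : measurable (unvisited a n k).
Proof.
rewrite unvisitedE; have [->|k0] := eqVneq k 0%N.
  rewrite (_ : [set i | _] = set0) ?bigcap_set0//.
  by apply/seteqP; split=> // i /=; rewrite addn0 => /andP[] /leq_ltn_trans/[apply]; rewrite ltnn.
apply: bigcap_measurable => //; exists n => /=.
by rewrite leqnn -[ltnLHS]addn0 ltn_add2l lt0n.
Qed.

Lemma unvisited_confined a n k : unvisited a n k `<=`
  confined (nseq n (xpredT : pred int) ++ nseq k (predC1 a : pred int)) 0.
Proof.
have conf m k' w : (forall i, (m <= i < m + k')%N -> a \notin Y i w) ->
    confined (nseq k' (predC1 a : pred int)) m w.
  elim: k' m => [//|k' IH] m H /=; split; last first.
    by apply: IH => i; rewrite addSnnS => /andP[mi ik]; apply: H; rewrite ik ltnW.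
  apply/allP => z zY /=; apply: contraNneq (H m _) => [<-//|].
  by rewrite leqnn -[ltnLHS]addn0 ltn_add2l.
suff free m w : (forall i, (m + n <= i < m + n + k)%N -> a \notin Y i w) ->
    confined (nseq n (xpredT : pred int) ++ nseq k (predC1 a : pred int)) m w.
  by move=> w H; apply: free.
elim: n m => [|n IH] m H /=; first by apply: conf; rewrite addn0 in H.
split; first by apply/allP.
by apply: IH; rewrite addSnnS.
Qed.

Lemma unvisited_le a x n k :
  (PP x (unvisited a n k) <= (survive pi b mu
     (nseq n (xpredT : pred int) ++ nseq k (predC1 a : pred int)) x)%:E)%E.
Proof.
apply: le_trans (confined_le _ _); apply: le_measure; rewrite ?inE.
- exact: measurable_unvisited.
- exact: measurable_confined.
- exact: unvisited_confined.
Qed.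

(** * Recurrence and the return time *)

Hypothesis decay : exists C : R, exists L0 : nat, 0 <= C /\
  forall a L n y, (L0 <= L)%N -> (`|y - a| <= L)%N ->
    avoid pi b mu a n y * n%:R ^+ 2 <= C * L%:R ^+ 2.

(** The quadratic decay is put in telescoping form, which sums without further
    work; the constants 6 and 2 come from
    [(k + 1) * (k + 2) <= 6 * k ^+ 2 + 2]. *)
Lemma unvisited_decay x n : exists2 K : R, 0 <= K &
  forall k, (PP x (unvisited x n k) <= (K * (k.+1%:R^-1 - k.+2%:R^-1))%:E)%E.
Proof.
have [C [L0 [C0 HC]]] := decay.
pose L := maxn L0 (n * b); pose K : R := 6 * (C * L%:R ^+ 2) + 2.
have B0 : 0 <= C * L%:R ^+ 2 by rewrite mulr_ge0 ?exprn_ge0.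
have K0 : 0 <= K by rewrite addr_ge0// mulr_ge0.
exists K => // k; pose c : R := K * (k.+1%:R^-1 - k.+2%:R^-1).
have k1 : 0 < k.+1%:R :> R by rewrite ltr0n.
have k2 : 0 < k.+2%:R :> R by rewrite ltr0n.
have cE : c = K / (k.+1%:R * k.+2%:R).
  rewrite /c; congr (_ * _); rewrite -[k.+2%:R]natr1; move: (k.+1%:R) k1 => t t0.
  by field; rewrite !gt_eqF ?addr_gt0.
have c0 : 0 <= c by rewrite cE divr_ge0// mulr_ge0 ?ltW.
have c01 : 0 <= Num.min 1 c <= 1 by rewrite le_min ler01 c0 ge_min lexx.
apply: le_trans (unvisited_le _ _ _ _) _; rewrite lee_fin.
apply: (@le_trans _ _ (Num.min 1 c)); last by rewrite ge_min lexx orbT.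
apply: (survive_free hpi hmu) => // z zx.
case/andP: (avoid01 hpi hmu x k z) => v0 v1; rewrite le_min v1 /= cE.
rewrite ler_pdivlMr ?mulr_gt0//.
have := HC x L k z (leq_maxl _ _) (leq_trans zx (leq_maxr _ _)).
rewrite -/(avoid pi b mu x k z); set v := avoid pi b mu x k z in v0 v1 * => vk.
have kk : k.+1%:R * k.+2%:R <= 6 * k%:R ^+ 2 + 2 :> R.
  rewrite -natrX -!natrM -natrD ler_nat; clear; nia.
apply: le_trans (ler_wpM2l v0 kk) _.
rewrite mulrDr mulrCA lerD ?ler_piMl// ler_wpM2l//.
Qed.

Definition unvisited_after (a : int) (n : nat) : set T :=
  [set w | forall i, (n <= i)%N -> a \notin Y i w].

Lemma measurable_unvisited_after a n : measurable (unvisited_after a n).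
Proof.
rewrite (_ : unvisited_after a n = \bigcap_(i in [set i | (n <= i)%N])
  (Y i @^-1` [set s : seq int | a \notin s]))//.
by apply: bigcap_measurable => //; exists n => /=.
Qed.

Lemma unvisited_after0 x n : PP x (unvisited_after x n) = 0%E.
Proof.
have [K K0 HK] := unvisited_decay x n.
have mU := measurable_unvisited_after x n.
apply/eqP; rewrite -measure_le0 -[leLHS]fineK ?fin_num_measure// lee_fin.
set q := fine _; rewrite leNgt; apply/negP => q0.
pose k := Num.truncn (K / q).
have : q <= K * (k.+1%:R^-1 - k.+2%:R^-1).
  rewrite -lee_fin fineK ?fin_num_measure//; apply: le_trans (HK k).
  apply: le_measure; rewrite ?inE//; first exact: measurable_unvisited.
  by move=> w H i /andP[ni _]; exact: H.
apply/negP; rewrite -ltNge; apply: (@le_lt_trans _ _ (K / k.+1%:R)).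
  by rewrite ler_wpM2l// gerBl invr_ge0.
rewrite ltr_pdivrMr ?ltr0n// mulrC -ltr_pdivrMr//.
exact: truncnS_gt.
Qed.

Let visits_at x n w : \bar R :=
  (\sum_(i < size (Y n w)) (position Y n w i == x)%:R%:E)%E.

Let visits_at_ge0 x n w : (0 <= visits_at x n w)%E.
Proof. by apply: sume_ge0 => i _; rewrite lee_fin. Qed.

Lemma position_mem x n w :
  (exists2 i, (i < size (Y n w))%N & position Y n w i = x) <-> x \in Y n w.
Proof. by split=> [/(nthP 0)|/(nthP 0)]. Qed.

Let visits_at_ge1 x n w : x \in Y n w -> (1 <= visits_at x n w)%E.
Proof.
move=> /position_mem[i iY ix]; rewrite /visits_at (bigD1 (Ordinal iY))//= ix eqxx.
by rewrite leeDl// sume_ge0// => j _; rewrite lee_fin.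
Qed.

Let visits_at0 x n w : x \notin Y n w -> visits_at x n w = 0%E.
Proof.
move=> xY; rewrite /visits_at big1// => i _; case: eqP => // ix; case/negP: xY.
by apply/position_mem; exists i.
Qed.

(** Each generation contributes a finite number of visits, hence infinitely many
    visits mean visits in infinitely many generations. *)
Lemma visits_infinite x :
  [set w | visits R Y x w = +oo%E] = ~` \bigcup_n unvisited_after x n.
Proof.
apply/seteqP; split=> w /=.
  move=> vw [n _ H]; have : (visits R Y x w < +oo)%E; last by rewrite vw.
  rewrite /visits (@nneseries_split _ _ 1 n); last by move=> k _; exact: visits_at_ge0.
  rewrite [X in (_ + X)%E]eseries0 ?adde0; last first.
    by move=> i ni _; apply: visits_at0; apply: H; lia.
  rewrite lte_sum_pinfty// => i _; rewrite lte_sum_pinfty// => j _.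
  exact: ltry.
move=> H.
have often n : exists2 i, (n <= i)%N & x \in Y i w.
  apply: contrapT => H'; apply: H; exists n => // i ni; apply/negP => xY.
  by apply: H'; exists i.
have partial (k : nat) : exists N, (k%:R%:E <= \sum_(1 <= n < N) visits_at x n w)%E.
  elim: k => [|k [N HN]]; first by exists 0%N; rewrite big_geq.
  have [i Ni xY] := often N.+1; exists i.+1.
  rewrite -natr1 EFinD big_nat_recr/=; last by lia.
  apply: leeD; last exact: visits_at_ge1.
  apply: le_trans HN _; rewrite [leRHS](@big_cat_nat _ _ _ (maxn N 1))/=; [|lia|lia].
  rewrite [X in (_ <= X + _)%E](_ : _ = \sum_(1 <= n < N) visits_at x n w)%E.
    by rewrite leeDl// sume_ge0// => j _.
  by have [N1|N1] //= := leqP 1 N; rewrite !big_geq// ltnW.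
apply/eq_infty => r; have [N HN] := partial (Num.truncn r).+1.
apply: (@le_trans _ _ (((Num.truncn r).+1%:R)%:E)).
  by rewrite lee_fin ltW// truncnS_gt.
apply: le_trans HN _; apply: nneseries_lim_ge => n _ _; exact: visits_at_ge0.
Qed.

Lemma alpha1 x : alpha PP Y x = 1%E.
Proof.
rewrite /alpha visits_infinite.
have mU : measurable (\bigcup_n unvisited_after x n).
  by apply: bigcup_measurable => n _; exact: measurable_unvisited_after.
rewrite probability_setC// (_ : PP x _ = 0%E) ?sube0//.
apply: measure_negligible => //; apply: negligible_bigcup => n.
by apply/negligibleP; [exact: measurable_unvisited_after|exact: unvisited_after0].
Qed.

(** The layer-cake formula: [unvisited x 1 k] is the event that the return time
    exceeds [k]. *)
Lemma return_timeE x w :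
  return_time R Y x w = (\sum_(0 <= k <oo) (\1_(unvisited x 1 k) w)%:E)%E.
Proof.
rewrite /return_time.
have [[n0 n0P]|none] := pselect (exists n, (0 < n)%N && (x \in Y n w)).
  have exN : exists n, (0 < n)%N && (x \in Y n w) by exists n0.
  case: (ex_minnP exN) => N /andP[N0 xN] Nmin.
  have indE k : \1_(unvisited x 1 k) w = (k < N)%:R :> R.
    rewrite indicE; congr ((nat_of_bool _)%:R); apply/idP/idP.
      rewrite inE => H; rewrite ltnNge; apply/negP => Nk.
      by move: (H N); rewrite N0 xN add1n ltnS Nk => /(_ isT).
    move=> kN; rewrite inE => i /andP[i0 ik]; apply/negP => xi.
    by have := Nmin i; rewrite i0 xi => /(_ isT); lia.
  rewrite (@nneseries_split _ _ 0 N); last by move=> k _; rewrite lee_fin.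
  rewrite [X in (_ + X)%E]eseries0 ?adde0; last first.
    by move=> i /= Ni _; rewrite indE ltnNge Ni.
  rewrite add0n (eq_big_nat _ _ (F2 := fun=> 1%E)); last first.
    by move=> i /andP[_ iN]; rewrite indE iN.
  rewrite sumEFin big_const_nat subn0 iter_addr_0.
  apply/eqP; rewrite eq_le; apply/andP; split.
    by apply: ereal_inf_lbound; exists N => //; split=> //; exact/position_mem.
  apply: le_ereal_inf_tmp => _ [n [n1 /position_mem xn] <-].
  by rewrite lee_fin ler_nat Nmin// n1.
rewrite (_ : [set n | _] = set0); last first.
  apply/seteqP; split=> // n [n1 /position_mem xn]; apply: none; exists n.
  by rewrite n1.
rewrite image_set0 ereal_inf0; apply/esym/eq_infty => r.
apply: (@le_trans _ _ (((Num.truncn r).+1%:R)%:E)).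
  by rewrite lee_fin ltW// truncnS_gt.
apply: le_trans (@nneseries_lim_ge _ _ _ 0 (Num.truncn r).+1 _); last first.
  by move=> k _ _; rewrite lee_fin.
rewrite (eq_big_nat _ _ (F2 := fun=> 1%E)); last first.
  move=> k _; rewrite indicE mem_set// => i /andP[i0 _]; apply/negP => xi.
  by apply: none; exists i; rewrite i0.
by rewrite sumEFin big_const_nat subn0 iter_addr_0.
Qed.

Lemma expected_return_time_finite x : (\int[PP x]_w return_time R Y x w < +oo)%E.
Proof.
have [K K0 HK] := unvisited_decay x 1.
under eq_integral do rewrite return_timeE.
have mU k := measurable_unvisited x 1 k.
rewrite integral_nneseries//; last first.
  by move=> k; apply/measurable_EFinP; exact: measurable_indic.
apply: (@le_lt_trans _ _ K%:E); last exact: ltry.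
apply: (@le_trans _ _ (\sum_(0 <= k <oo) (K * (k.+1%:R^-1 - k.+2%:R^-1))%:E)%E).
  apply: lee_nneseries => [k _ _|k _]; first by apply: integral_ge0 => w _; rewrite lee_fin.
  by rewrite integral_indic// setIT; exact: HK.
apply: nneseries_le => [k|n].
  by rewrite mulr_ge0// subr_ge0 lef_pV2 ?posrE ?ltr0n// ler_nat.
rewrite -mulr_sumr ler_piMr//.
have -> : \sum_(0 <= k < n) (k.+1%:R^-1 - k.+2%:R^-1) = 1 - n.+1%:R^-1 :> R.
  elim: n => [|n IH]; first by rewrite big_geq// invr1 subrr.
  by rewrite big_nat_recr//= IH addrA subrK.
by rewrite gerBl invr_ge0.
Qed.

End Process.

Lemma jump_law_of_iid (R : realType) (d0 : measure_display)
    (T0 : measurableType d0) (P0 : probability T0 R) (X : nat -> T0 -> int) :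
  iid P0 X -> bounded_jumps P0 X ->
  exists b, jump_law (fun z => fine (P0 [set w | X 0%N w = z])) b.
Proof.
move=> [mX _ _] [b hb]; exists b.
have mz z : measurable [set w | X 0%N w = z] by exact: (mX 0%N [set z]).
split=> [z|z bz|].
- by rewrite fine_ge0.
- rewrite (_ : P0 _ = 0%E)//; apply: measure_negligible => //.
  apply: negligibleS (hb 0%N) => w /= ->; apply/negP; rewrite -ltNge.
  by rewrite -abszE ltz_nat.
rewrite -lee_fin -sumEFin.
under eq_bigr do rewrite fineK ?fin_num_measure//.
rewrite -(@measure_bigsetU_ord _ _ _ P0 _ xpredT (fun i => [set w | X 0%N w = jump i]))//.
  by apply: probability_le1; exact: bigsetU_measurable.
move=> i j _ _ [w [/= -> ]]; rewrite /jump => ij; apply: val_inj => /=; lia.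
Qed.

Theorem theorem4p8 (R : realType)
    (d0 : measure_display) (T0 : measurableType d0) (P0 : probability T0 R)
    (X : nat -> T0 -> int)
    (hiid : iid P0 X)
    (hbdd : bounded_jumps P0 X)
    (hdrift : drift_right P0 X)
    (hirr : irreducible (transition P0 X))
    (mu : nat -> R) (m : R)
    (hmu : offspring_distribution mu)
    (hmean : offspring_mean mu m)
    (x0 y0 : int)
    (hm : 1 / spectral_radius (transition P0 X) x0 y0 < m)
    (d : measure_display) (T : measurableType d)
    (PP : int -> probability T R) (Y : nat -> T -> seq int)
    (hbrw : branching_random_walk (transition P0 X) mu PP Y) :
  positive_recurrent PP Y.
Proof.
have [b hpi] := jump_law_of_iid hiid hbdd.
set pi := (fun z : int => _) in hpi.
have pE : transition P0 X = (fun x y : int => pi (y - x)).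
  apply/funext => x; apply/funext => y; rewrite /transition /pi; congr (fine (P0 _)).
  by apply/seteqP; split=> w /= => [<-|->]; lia.
rewrite pE in hirr hm hbrw.
have [m' /andP[m'0 m'm] Hm'] := supercritical_path hpi hirr hm.
have [s0 hs0 near1] := pgf_near1 hmu hmean m'm.
have [N1 H1] := Hm' 0 1; have [N2 H2] := Hm' 0 (-1).
have m'_gt1 : 1 < m'.
  rewrite ltNge; apply/negP => m'1; move: H1; apply/negP; rewrite -leNgt.
  by rewrite mulr_ile1 ?exprn_ge0 ?exprn_ile1 ?(nstep_ge0 hpi) ?(nstep_le1 hpi)// ltW.
have decay := avoid_quadratic hpi hmu near1 m'_gt1 hs0 (ltW H1) (ltW H2).
split=> x; last exact: (expected_return_time_finite hpi hmu hbrw decay).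
by rewrite (alpha1 hpi hmu hbrw decay).
Qed.
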